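(* Let $\Gamma$ be a finitely generated abelian group and $F$ an endomorphism of $\Gamma$. Suppose $\Sigma$ is an $F$-spanning set for $\Gamma$, $\Theta$ is an $F^r$-spanning set for $\Gamma$ for some integer $r>0$, and $S\subseteq\Gamma$. If $S$ is $(\Sigma,F)$-automatic then $S$ is $(\Theta,F^r)$-automatic. In particular (taking $r=1$ and by symmetry), $(\Sigma,F)$-automaticity does not depend on the choice of $F$-spanning set $\Sigma$: if $\Sigma$ and $\Theta$ are both $F$-spanning sets, then $S$ is $(\Sigma,F)$-automatic if and only if it is $(\Theta,F)$-automatic.
   Context: For a finite word $x_0x_1\cdots x_m$ with letters in $\Gamma$ put $[x_0x_1\cdots x_m]_F:=x_0+Fx_1+\cdots+F^mx_m$, and $[\emptyset]_F:=0$ for the empty word. A finite subset $\Sigma\subseteq\Gamma$ is an $F$-spanning set for $\Gamma$ if: (i) $0\in\Sigma$ and $x\in\Sigma\Rightarrow -x\in\Sigma$; (ii) for $x\in\Gamma$, $Fx\in\Sigma\Rightarrow x\in\Sigma$; (iii) every $x\in\Gamma$ equals $[x_0\cdots x_m]_F$ for some $m\ge 0$ and $x_0,\dots,x_m\in\Sigma$; (iv) for all $x_1,\dots,x_5\in\Sigma$ there are $t,t'\in\Sigma$ with $x_1+\cdots+x_5=t+Ft'$; (v) if $x_1,x_2,x_3\in\Sigma$ and $x_1+x_2+x_3\in F(\Gamma)$ then there is $t\in\Sigma$ with $x_1+x_2+x_3=Ft$. The notions of $F^r$-spanning set and $[w]_{F^r}$ are obtained by replacing $F$ by $F^r$. $\Sigma^*$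 denotes the set of finite words on $\Sigma$. If $\Sigma$ is an $F$-spanning set, a subset $S\subseteq\Gamma$ is $(\Sigma,F)$-automatic if $\{w\in\Sigma^*:[w]_F\in S\}$ is a regular language (accepted by a finite automaton reading left to right); similarly with $F^r$ and an $F^r$-spanning set. *)

(* Defs.v *)
From HB Require Import structures.
From mathcomp Require Import all_boot all_order all_algebra finmap.
Set Implicit Arguments.
Unset Strict Implicit.
Unset Printing Implicit Defensive.
Import GRing.Theory.
Local Open Scope fset_scope.
Local Open Scope ring_scope.

Definition finitely_generated (G : zmodType) : Prop :=
  exists (n : nat) (g : 'I_n -> G),
    forall x : G, exists c : 'I_n -> int, x = \sum_(i < n) g i *~ c i.

Definition bracket (G : zmodType) (F : G -> G) (w : seq G) : G :=
  \sum_(i < size w) iter i F w`_i.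

Record spanning_set (G : zmodType) (F : G -> G) (Sg : {fset G}) : Prop :=
  SpanningSet {
    spanning_zero : 0 \in Sg;
    spanning_opp : forall x, x \in Sg -> - x \in Sg;
    spanning_preimage : forall x, F x \in Sg -> x \in Sg;
    spanning_word : forall x : G, exists w : seq G,
      [/\ w <> [::], {subset w <= Sg} & x = bracket F w];
    spanning_sum5 : forall x1 x2 x3 x4 x5,
      x1 \in Sg -> x2 \in Sg -> x3 \in Sg -> x4 \in Sg -> x5 \in Sg ->
      exists t t', [/\ t \in Sg, t' \in Sg &
                       x1 + x2 + x3 + x4 + x5 = t + F t'];
    spanning_sum3 : forall x1 x2 x3,
      x1 \in Sg -> x2 \in Sg -> x3 \in Sg ->
      (exists y : G, x1 + x2 + x3 = F y) ->
      exists2 t, t \in Sg & x1 + x2 + x3 = F t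
  }.

Record dfa (A : finType) := DFA {
  dfa_state : finType;
  dfa_start : dfa_state;
  dfa_step : dfa_state -> A -> dfa_state;
  dfa_final : pred dfa_state
}.

Definition dfa_accept (A : finType) (M : dfa A) (w : seq A) : bool :=
  dfa_final (foldl (@dfa_step A M) (dfa_start M) w).

Definition regular (A : finType) (L : seq A -> Prop) : Prop :=
  exists M : dfa A, forall w : seq A, L w <-> dfa_accept M w.

(* Words over Sg are sequences over the finite type of elements of Sg; [val]
   maps letters to G. The empty word is included, with value 0. *)
Definition automatic (G : zmodType) (F : G -> G) (Sg : {fset G})
    (S : G -> Prop) : Prop :=
  regular (fun w : seq Sg => S (bracket F (map val w))).

(* Main.v *)
Require Import Defs.
From HB Require Import structures.
From mathcomp Require Import all_boot all_order all_algebra finmap.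
Local Open Scope fset_scope.
Local Open Scope ring_scope.
Set Implicit Arguments.
Unset Strict Implicit.
Unset Printing Implicit Defensive.
Import GRing.Theory.

(** Automata read the least significant digit first, so a Theta-expansion can
    be rewritten as a Sigma-expansion on the fly, by a transducer which keeps a
    carry.  The point is that the carry stays in a finite set.

    Let B_M be the set of values of Sigma-words of length M.  Adding three such
    words digit by digit and applying the axiom on sums of five digits (with
    two digits 0) to each position gives B_M + B_M + B_M inside B_M + F(B_M),
    and splitting off the lowest digit of the first summand gives
    B_M + B_M + B_M inside Sigma + F(B_M + B_M) ([block_carry]).  Since Theta is
    finite and every element of the group is the value of a Sigma-word, Theta
    lies in B_M for M large.  With carries C = B_M + B_M, one therefore has
    C + Theta inside Sigma + F(C); followed by r - 1 more steps with input 0,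
    this puts c + theta in the form [u]_F + F^r c', where u has length r and c'
    is again in C ([carry_system]).

    Now run an automaton for the Sigma-expansions of S on the words u emitted
    by the transducer.  After a Theta-word w has been read, with output v and
    carry c, one has [w]_{F^r} = [v]_F + F^{|v|} c.  If e is a fixed Sigma-word
    of value c, then this is [v e]_F, so membership in S is decided by feeding e
    to the automaton, that is, by the current pair of carry and state alone
    ([transducer_automatic]). *)

(** * Values of words *)

Section Bracket.

Variable G : zmodType.

Lemma iter_zmod_morphism (F : {additive G -> G}) r :
  zmod_morphism (iter r F).
Proof. by move=> x y; elim: r => //= r ->; rewrite raddfB. Qed.

HB.instance Definition _ (F : {additive G -> G}) r :=
  GRing.isZmodMorphism.Build G G (iter r F) (iter_zmod_morphism F r).

Lemma bracket_nil (F : G -> G) : bracket F [::] = 0.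
Proof. by rewrite /bracket big_ord0. Qed.

Lemma bracket_cons (F : {additive G -> G}) x w :
  bracket F (x :: w) = x + F (bracket F w).
Proof. by rewrite /bracket big_ord_recl raddf_sum. Qed.

Lemma bracket_cat (F : {additive G -> G}) u v :
  bracket F (u ++ v) = bracket F u + iter (size u) F (bracket F v).
Proof.
elim: u => [|x u IH] /=; first by rewrite bracket_nil add0r.
by rewrite !bracket_cons IH raddfD addrA.
Qed.

End Bracket.

(** * Finiteness of the carries *)

Section Carry.

Variables (G : zmodType) (F : {additive G -> G}) (Sg : {fset G}).
Hypothesis spanSg : spanning_set F Sg.

(** The values of the words of length [M] over [Sg]. *)
Fixpoint block (M : nat) : {fset G} :=
  if M is M'.+1 then [fset s + F b | s in Sg, b in block M'] else [fset 0].

Lemma blockS M x :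
  reflect (exists s b, [/\ s \in Sg, b \in block M & x = s + F b])
          (x \in block M.+1).
Proof.
apply: (iffP (imfset2P _ _ _ _ _)) => [[s /= sS [b /= bB ->]]|[s [b [sS bB ->]]]].
  by exists s, b.
by exists s => //; exists b.
Qed.

Lemma block0 M : 0 \in block M.
Proof.
elim: M => [|M IH]; first by rewrite inE.
by apply/blockS; exists 0, 0; rewrite raddf0 addr0 (spanning_zero spanSg).
Qed.

(** Words can be padded by high-order digits 0. *)
Lemma block_widen M N : (M <= N)%N -> block M `<=` block N.
Proof.
move=> leMN; apply/fsubsetP => x; elim: M N leMN x => [|M IH] [|N] //.
  by move=> _ x /fset1P ->; apply: block0.
move=> leMN x /blockS[s [b [sS bB ->]]].
by apply/blockS; exists s, b; rewrite (IH N).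
Qed.

Lemma block_bracket w :
  {subset w <= Sg} -> bracket F w \in block (size w).
Proof.
elim: w => [|x w IH] wS; first by rewrite bracket_nil inE.
rewrite bracket_cons; apply/blockS; exists x, (bracket F w); split => //.
  by apply: wS; rewrite mem_head.
by apply: IH => y yw; apply: wS; rewrite inE yw orbT.
Qed.

Lemma fset_sub_block (T : {fset G}) : exists M, T `<=` block M.
Proof.
have [M MT] : exists M, {subset enum_fset T <= block M}.
  elim: (enum_fset T) => [|x s [M sM]]; first by exists 0%N.
  have [w [_ wS xE]] := spanning_word spanSg x.
  exists (maxn (size w) M) => y; rewrite inE => /predU1P[->|ys].
    apply: (fsubsetP (block_widen (leq_maxl _ _))).
    by rewrite xE; apply: block_bracket.
  by apply: (fsubsetP (block_widen (leq_maxr _ _))); apply: sM.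
by exists M; apply/fsubsetP.
Qed.

(** All positions are reduced at once, without propagating carries: the low
    parts of the digit sums form one word and the high parts another one,
    shifted by one position. *)
Lemma block_sum3 M x y z : x \in block M -> y \in block M -> z \in block M ->
  exists a b, [/\ a \in block M, b \in block M & x + y + z = a + F b].
Proof.
elim: M x y z => [|M IH] x y z.
  move=> /fset1P-> /fset1P-> /fset1P->; exists 0, 0.
  by rewrite block0 raddf0 !addr0.
move=> /blockS[x0 [x' [x0S x'B ->]]] /blockS[y0 [y' [y0S y'B ->]]].
move=> /blockS[z0 [z' [z0S z'B ->]]].
have [a [b [aB bB sumE]]] := IH _ _ _ x'B y'B z'B.
have S0 := spanning_zero spanSg.
have [t [t' [tS t'S]]] := spanning_sum5 spanSg x0S y0S z0S S0 S0.
rewrite !addr0 => digitE.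
exists (t + F a), (t' + F b); split.
- by apply/blockS; exists t, a.
- by apply/blockS; exists t', b.
rewrite [LHS](_ : _ = x0 + y0 + z0 + F (x' + y' + z')).
  by rewrite digitE sumE !raddfD addrACA.
by rewrite !raddfD (addrACA x0) (addrACA (x0 + y0)).
Qed.

Lemma block_split M x : x \in block M ->
  exists s b, [/\ s \in Sg, b \in block M & x = s + F b].
Proof.
case: M => [/fset1P ->|M /blockS[s [b [sS bB ->]]]].
  by exists 0, 0; rewrite block0 raddf0 addr0 (spanning_zero spanSg).
by exists s, b; rewrite (fsubsetP (block_widen (leqnSn M))).
Qed.

Definition carries M : {fset G} := [fset a + b | a in block M, b in block M].

Lemma carriesP M x :
  reflect (exists a b, [/\ a \in block M, b \in block M & x = a + b])
          (x \in carries M).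
Proof.
apply: (iffP (imfset2P _ _ _ _ _)) => [[a /= aB [b /= bB ->]]|[a [b [aB bB ->]]]].
  by exists a, b.
by exists a => //; exists b.
Qed.

Lemma carries0 M : 0 \in carries M.
Proof. by apply/carriesP; exists 0, 0; rewrite block0 addr0. Qed.

(** Splitting the lowest digit off the low part leaves two words of length
    [M] as the new carry, which is why carries are sums of two blocks. *)
Lemma block_carry M c z : c \in carries M -> z \in block M ->
  exists s c', [/\ s \in Sg, c' \in carries M & c + z = s + F c'].
Proof.
move=> /carriesP[x [y [xB yB ->]]] zB.
have [a [b [aB bB ->]]] := block_sum3 xB yB zB.
have [s [a' [sS a'B ->]]] := block_split aB.
exists s, (a' + b); rewrite raddfD addrA; split => //.
by apply/carriesP; exists a', b.
Qed.

(** Only the first of the [r] steps has a nonzero input: in base [F], the digit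
    [z] of a base [F^r] expansion is followed by [r - 1] digits 0. *)
Lemma block_carry_iter M r c z : (0 < r)%N ->
  c \in carries M -> z \in block M ->
  exists u c', [/\ size u = r, {subset u <= Sg}, c' \in carries M &
                   c + z = bracket F u + iter r F c'].
Proof.
case: r => // r _; elim: r c z => [|r IH] c z cC zB;
  have [s [c1 [sS c1C ->]]] := block_carry cC zB.
  exists [:: s], c1; rewrite bracket_cons bracket_nil raddf0 addr0.
  by split => // y; rewrite inE => /eqP ->.
have [u [c' [su uS c'C]]] := IH c1 0 c1C (block0 M).
rewrite addr0 => ->; exists (s :: u), c'; rewrite /= su; split => //.
  by move=> y; rewrite inE => /predU1P[->|/uS].
by rewrite bracket_cons raddfD addrA.
Qed.

Lemma seq_fsetP (u : seq G) : {subset u <= Sg} ->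
  exists v : seq Sg, u = map val v.
Proof.
elim: u => [|x u IH] uS; first by exists [::].
have [|v ->] := IH; first by move=> y yu; apply: uS; rewrite inE yu orbT.
have xS : x \in Sg by apply: uS; rewrite mem_head.
by exists ([` xS] :: v).
Qed.

(** Outputs and carries are packed in a choice type, and the equation is
    boolean, so that a transition function can be extracted by [xchoose]. *)
Lemma carry_system r (Th : {fset G}) : (0 < r)%N ->
  exists2 C : {fset G}, 0 \in C &
    forall (c : C) (z : Th), exists p : r.-tuple Sg * C,
      val c + val z == bracket F (map val p.1) + iter r F (val p.2).
Proof.
move=> r_gt0; have [M ThM] := fset_sub_block Th.
exists (carries M) => [|c z]; first exact: carries0.
have zB := fsubsetP ThM _ (valP z).
have [u [c' [su uS c'C cE]]] := block_carry_iter r_gt0 (valP c) zB.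
have [v uE] := seq_fsetP uS.
have sv : size v == r by rewrite -su uE size_map.
by exists (Tuple sv, [` c'C]); rewrite cE uE.
Qed.

Lemma bracket_surj x : exists w : seq Sg, x == bracket F (map val w).
Proof.
have [w [_ wS ->]] := spanning_word spanSg x.
by have [v ->] := seq_fsetP wS; exists v.
Qed.

End Carry.

(** * The transducer *)

Section Transducer.

Variables (G : zmodType) (F : {additive G -> G}) (Sg Th C : {fset G}) (r : nat).
Hypothesis surjSg : forall x, exists w : seq Sg, x == bracket F (map val w).
Hypothesis C0 : 0 \in C.
Hypothesis carryC : forall (c : C) (z : Th), exists p : r.-tuple Sg * C,
  val c + val z == bracket F (map val p.1) + iter r F (val p.2).

Definition expansion (x : G) : seq Sg := xchoose (surjSg x).

Lemma expansionK x : bracket F (map val (expansion x)) = x.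
Proof. exact/esym/eqP/(xchooseP (surjSg x)). Qed.

Definition carry (c : C) (z : Th) : r.-tuple Sg * C := xchoose (carryC c z).

Lemma carryE c z : val c + val z =
  bracket F (map val (carry c z).1) + iter r F (val (carry c z).2).
Proof. exact/eqP/(xchooseP (carryC c z)). Qed.

(** A state is accepting when the automaton for [Sg] would accept after
    reading, on top of the digits already emitted, an expansion of the
    carry. *)
Definition carry_dfa (A : dfa Sg) : dfa Th :=
  @DFA Th (C * dfa_state A)%type ([` C0], dfa_start A)
    (fun cq z => let p := carry cq.1 z in (p.2, foldl (@dfa_step _ A) cq.2 p.1))
    (fun cq => @dfa_final _ A
       (foldl (@dfa_step _ A) cq.2 (expansion (val cq.1)))).

Lemma carry_dfa_run (A : dfa Sg) (w : seq Th) (c : C) (q : dfa_state A) :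
  let cq := foldl (@dfa_step _ (carry_dfa A)) (c, q) w in
  exists v : seq Sg, cq.2 = foldl (@dfa_step _ A) q v /\
    val c + bracket (iter r F) (map val w) =
    bracket F (map val v) + iter (size v) F (val cq.1).
Proof.
elim: w c q => [|z w IH] c q /=.
  by exists [::]; rewrite !bracket_nil add0r addr0.
have cE := carryE c z; case: (carry c z) cE => u c' /= cE.
have [v [-> vE]] := IH c' (foldl (@dfa_step _ A) q u).
exists (u ++ v); rewrite foldl_cat; split => //.
rewrite bracket_cons addrA cE -addrA -raddfD vE raddfD.
by rewrite map_cat bracket_cat !size_map size_cat size_tuple iterD addrA.
Qed.

Lemma transducer_automatic (S : G -> Prop) :
  automatic F Sg S -> automatic (iter r F) Th S.
Proof.
case=> A acceptA; exists (carry_dfa A) => w; rewrite /dfa_accept /=.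
have [v [-> ]] := carry_dfa_run w [` C0] (dfa_start A).
rewrite /= add0r => ->; set c := val _.
rewrite -{1}(expansionK c) -(size_map val v) -bracket_cat -map_cat -foldl_cat.
exact: acceptA.
Qed.

End Transducer.

Theorem proposition6p3 (G : zmodType) (Gfg : finitely_generated G)
    (F : {additive G -> G}) :
  (forall (r : nat) (Sg Th : {fset G}) (S : G -> Prop),
     (0 < r)%N ->
     spanning_set F Sg ->
     spanning_set (iter r F) Th ->
     automatic F Sg S ->
     automatic (iter r F) Th S)
  /\
  (forall (Sg Th : {fset G}) (S : G -> Prop),
     spanning_set F Sg ->
     spanning_set F Th ->
     (automatic F Sg S <-> automatic F Th S)).
Proof.
have main r (Sg Th : {fset G}) (S : G -> Prop) : (0 < r)%N ->
    spanning_set F Sg -> automatic F Sg S -> automatic (iter r F) Th S.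
  move=> r_gt0 spanSg; have [C C0 carryC] := carry_system spanSg Th r_gt0.
  exact: transducer_automatic (bracket_surj spanSg) C0 carryC S.
split=> [r Sg Th S r_gt0 spanSg _|Sg Th S spanSg spanTh]; first exact: main.
by split; apply: (main 1%N).
Qed.
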